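(* Let $\varphi$ be a quantifier-free conjunction of equality literals, let $G=\langle N,E,L,\mathit{root}\rangle=\mathit{egraph}(\varphi)$, and let $r$ be an admissible representative function for $G$ that is maximally ground. For every node $n\in N$, if $\varphi\models\mathit{ntt}(n)\approx t$ for some ground term $t$, then $r(n)$ is c-ground and $\mathit{toexpr}(r(n),r)$ is a ground term.
   Context: Work in multi-sorted first-order logic whose signature has only function symbols and constants; predicates are $\mathsf{Bool}$-valued functions, and a literal $P(a)$ abbreviates $P(a)\approx\top$. Entailment $\models$ is that of the theory of equality with uninterpreted functions. A term is ground if it contains no (logical) variables. An egraph is a tuple $G=\langle N,E,L,\mathit{root}\rangle$ where $\langle N,E\rangle$ is a finite directed acyclic graph with ordered successors ($n[i]$ is the $i$-th child of $n$, $\deg(n)$ its out-degree, a leaf has out-degree 0), $L$ maps each node to a function symbol or a logical variable, and $\mathit{root}:N\to N$ is such that $\rho_{\mathit{root}}=\{(n,n')\mid\mathit{root}(n)=\mathit{root}(n')\}$ is an equivalence relation closed under congruence (if $L(n)=L(n')$, $\deg(n)=\deg(n')>0$ and all $(n[i],n'[i])\in\rho_{\mathit{root}}$, then $(n,n')\in\rho_{\mathit{root}}$). $\mathit{class}(n)=\rho_{\mathit{root}}(n)$. The term of $n$ is $\mathit{ntt}(n)=L(n)$ if $\deg(n)=0$ and $L(n)(\mathit{ntt}(n[1]),\dots,\mathit{ntt}(n[\deg(n)]))$ otherwise; distinct nodes have distinct terms. For a conjunction of equalities $\varphi$, $\mathit{egraph}(\varphi)$ has one node per subterm of $\varphi$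 and $\rho_{\mathit{root}}$ is the congruence closure of the equalities of $\varphi$. A representative function is $r:N\to N$. $\mathit{toexpr}(n,r)=L(n)$ if $\deg(n)=0$, and $L(n)(\mathit{toexpr}(r(n[1]),r),\dots,\mathit{toexpr}(r(n[\deg(n)]),r))$ otherwise. $r$ is admissible for $G$ if (a) $r(n)\in\mathit{class}(n)$ and $r$ is constant on each class, (b) $\rho_{\mathit{root}}=\{(n,n')\mid r(n)=r(n')\}$, and (c) the graph $G_r=\langle N,E_r\rangle$, $E_r=\{(n,r(c))\mid c\text{ a child of }n\}$, is acyclic. C-groundness is defined inductively (least fixed point): a class is ground if it contains a c-ground node; a node $n$ is c-ground if either $\mathit{ntt}(n)$ is ground, or $n$ is not a leaf and $\mathit{class}(n[i])$ is ground for every child $n[i]$. (Nodes labeled by variables are never c-ground.) $r$ is maximally ground if for every $n\in N$, whenever $\mathit{class}(n)$ is ground, $r(n)$ is c-ground. *)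

(* Defs.v *)
From HB Require Import structures.
From mathcomp Require Import all_boot.
Set Implicit Arguments.
Unset Strict Implicit.
Unset Printing Implicit Defensive.

(* Predicates are [boolS]-valued symbols and P(a) abbreviates P(a) = top.     *)
(* [boolS] and [topF] are distinguished syntactically but are uninterpreted   *)
(* like the rest of the signature: entailment below is that of pure EUF.      *)
Record signature := Signature {
  ssort : eqType;
  funsym : eqType;
  lvar : eqType;
  fdom : funsym -> seq ssort;
  fcod : funsym -> ssort;
  vsort : lvar -> ssort;
  boolS : ssort;
  topF : funsym;
  topF_dom : fdom topF = [::];
  topF_cod : fcod topF = boolS
}.

Section Terms.
Variable S : signature.

(* Raw terms; a constant is [App c [::]]. Sorting is imposed by [wf_term].    *)
Inductive term : Type :=
| Var of lvar S
| App of funsym S & seq term.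

Fixpoint enc_term (t : term) : GenTree.tree (lvar S + funsym S) :=
  match t with
  | Var x => GenTree.Leaf (inl x)
  | App f ts => GenTree.Node 0 (GenTree.Leaf (inr f) :: map enc_term ts)
  end.

Fixpoint dec_term (u : GenTree.tree (lvar S + funsym S)) : option term :=
  match u with
  | GenTree.Leaf (inl x) => Some (Var x)
  | GenTree.Node _ (GenTree.Leaf (inr f) :: us) => Some (App f (pmap dec_term us))
  | _ => None
  end.

Lemma enc_termK : pcancel enc_term dec_term.
Proof.
rewrite /pcancel; fix IH 1; case=> [x|f ts] //=; congr (Some (App f _)).
by elim: ts => [|t ts IHts] //=; rewrite IH /= IHts.
Qed.

HB.instance Definition _ := Equality.copy term (pcan_type enc_termK).

Definition sort_of (t : term) : ssort S :=
  match t with Var x => vsort x | App f _ => fcod f end.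

Fixpoint wf_term (t : term) : bool :=
  match t with
  | Var _ => true
  | App f ts => (map sort_of ts == fdom f) && all wf_term ts
  end.

Fixpoint ground (t : term) : bool :=
  match t with
  | Var _ => false
  | App _ ts => all ground ts
  end.

Definition ground_term (t : term) : bool := wf_term t && ground t.

Fixpoint subterms (t : term) : seq term :=
  t :: match t with
       | Var _ => [::]
       | App _ ts => flatten (map subterms ts)
       end.

Definition literal : Type := (term * term)%type.
Definition formula : Type := seq literal.

Definition wf_literal (l : literal) : bool :=
  [&& wf_term l.1, wf_term l.2 & sort_of l.1 == sort_of l.2].

Definition wf_formula (phi : formula) : bool := all wf_literal phi.

Definition formula_subterms (phi : formula) : seq term :=
  flatten [seq subterms l.1 ++ subterms l.2 | l <- phi].

(* The domain of sort [s] is the fibre of [usort] over [s], i.e. [univ] is    *)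
(* the disjoint union of the (nonempty) domains; the value of [fint f] is     *)
(* only relevant on argument lists of sorts [fdom f].                         *)
Record structure := Structure {
  univ : Type;
  usort : univ -> ssort S;
  dom_nonempty : forall s, exists u, usort u = s;
  fint : funsym S -> seq univ -> univ;
  fint_sort : forall f us, map usort us = fdom f -> usort (fint f us) = fcod f
}.

Definition assignment (M : structure) (a : lvar S -> univ M) : Prop :=
  forall x, usort (a x) = vsort x.

Fixpoint eval (M : structure) (a : lvar S -> univ M) (t : term) : univ M :=
  match t with
  | Var x => a x
  | App f ts => fint f (map (eval a) ts)
  end.

Definition holds (M : structure) (a : lvar S -> univ M) (l : literal) : Prop :=
  eval a l.1 = eval a l.2.

Definition entails (phi : formula) (l : literal) : Prop :=
  forall (M : structure) (a : lvar S -> univ M), assignment a ->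
    (forall l', l' \in phi -> holds a l') -> holds a l.

End Terms.

Definition acyclic (N : finType) (e : rel N) : Prop :=
  forall n m, e n m -> ~~ connect e m n.

Section Egraphs.
Variable S : signature.

Record tgraph := TGraph {
  node : finType;
  child : node -> seq node;
  label : node -> funsym S + lvar S;
  eroot : node -> node
}.

Variable G : tgraph.
Local Notation N := (node G).

Definition deg (n : N) : nat := size (child n).

(* Children are numbered from 0; the default [n] is never used for i < deg n. *)
Definition nth_child (n : N) (i : nat) : N := nth n (child n) i.

Definition edge : rel N := [rel n m | m \in child n].

Definition edge_repr (r : N -> N) : rel N :=
  [rel n m | m \in map r (child n)].

Definition mk_term (l : funsym S + lvar S) (ts : seq (term S)) : term S :=
  match l with inl f => App f ts | inr x => Var x end.

(* Recursion along [edge_repr r], bounded by the number of nodes. The bound   *)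
(* is never reached when that graph is acyclic: see [toexprE].                *)
Fixpoint toexpr_rec (r : N -> N) (k : nat) (n : N) : term S :=
  mk_term (label n)
    (if k is k'.+1 then [seq toexpr_rec r k' (r c) | c <- child n] else [::]).

Definition toexpr (n : N) (r : N -> N) : term S := toexpr_rec r #|N| n.

Lemma toexprE (r : N -> N) (n : N) : acyclic (edge_repr r) ->
  toexpr n r = mk_term (label n) [seq toexpr (r c) r | c <- child n].
Proof.
move=> acy; rewrite /toexpr.
suff stable k : forall m, #|connect (edge_repr r) m| <= k.+1 ->
    toexpr_rec r k m = toexpr_rec r k.+1 m.
  by rewrite (stable #|N|) //; apply: leqW; apply: max_card.
elim: k => [|k IHk] m hm /=; congr (mk_term _ _).
- case def_m: (child m) => [|c cs] //=; move: hm.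
  have mc : edge_repr r m (r c) by rewrite /edge_repr /= def_m mem_head.
  have := acy _ _ mc; case: (eqVneq (r c) m) => [->|neq _]; first by rewrite connect0.
  move=> /card_le1P/(_ m (connect0 _ _))/(_ (r c)).
  by rewrite -!topredE /= connect1 // (negPf neq).
- apply/eq_in_map => c mc; apply: IHk.
  have mrc : edge_repr r m (r c) by rewrite /edge_repr /= map_f.
  rewrite -ltnS; apply: leq_trans hm; apply: proper_card; apply/properP; split.
    apply/subsetP => x; rewrite -!topredE /=; exact: connect_trans (connect1 mrc).
  by exists m; rewrite -?topredE /= ?connect0 // acy.
Qed.

(* ntt satisfies the same recursion as toexpr with the identity in place of r *)
Definition ntt (n : N) : term S := toexpr n id.

Lemma nttE (n : N) : acyclic edge ->
  ntt n = mk_term (label n) (map ntt (child n)).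
Proof.
move=> acy; rewrite /ntt toexprE // => x y; rewrite /edge_repr /= map_id => /acy.
by rewrite (@eq_connect _ _ edge) // => u v; rewrite /edge_repr /= map_id.
Qed.

Definition rho_root : rel N := [rel n m | eroot n == eroot m].

Definition class (n : N) : {set N} := [set m | rho_root n m].

Definition congruence_closed (R : rel N) : Prop :=
  forall n n', label n = label n' -> deg n = deg n' -> 0 < deg n ->
    (forall i, i < deg n -> R (nth_child n i) (nth_child n' i)) -> R n n'.

Definition is_egraph : Prop :=
  [/\ acyclic edge,
      forall n x, label n = inr x -> deg n = 0,
      equivalence_rel rho_root /\ congruence_closed rho_root
    & injective ntt].

Definition congruence_closure (phi : formula S) (n m : N) : Prop :=
  forall R : rel N, equivalence_rel R -> congruence_closed R ->
    (forall n1 n2, (ntt n1, ntt n2) \in phi -> R n1 n2) -> R n m.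

(* [eroot] is determined by [phi] only up to the choice of a value per class, *)
(* hence a predicate rather than a function of [phi].                         *)
Definition egraph_of (phi : formula S) : Prop :=
  [/\ is_egraph,
      forall t, (exists n, ntt n = t) <-> t \in formula_subterms phi
    & forall n m, rho_root n m <-> congruence_closure phi n m].

Inductive class_ground : {set N} -> Prop :=
| ClassGround (C : {set N}) (n : N) : n \in C -> cground n -> class_ground C
with cground : N -> Prop :=
| GroundNtt (n : N) : ground (ntt n) -> cground n
| GroundChildren (n : N) : 0 < deg n ->
    (forall i, i < deg n -> class_ground (class (nth_child n i))) -> cground n.

Definition admissible (r : N -> N) : Prop :=
  [/\ forall n, r n \in class n,
      forall n m, m \in class n -> r m = r n,
      forall n m, rho_root n m <-> r n = r m
    & acyclic (edge_repr r)].

Definition maximally_ground (r : N -> N) : Prop :=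
  forall n, class_ground (class n) -> cground (r n).

End Egraphs.

(* Main.v *)
(** Every class of the egraph has a single sort, so the classes together with
    one extra element per sort form the universe of a structure: a function
    symbol applied to the classes of the children of a node it labels yields the
    class of that node, and the extra element on all other arguments. Mapping
    the variables to their classes makes each [ntt n] denote the class of [n],
    hence satisfies [phi], whereas a ground term can only denote a ground class
    or an extra element. So [phi |= ntt n = t] with [t] ground forces the class
    of [n] to be ground, and groundness of [toexpr (r n) r] follows by
    well-founded induction along [edge_repr r]. *)

Require Import Defs.
From mathcomp Require Import all_boot.

(** The number of reachable nodes drops along an edge [e n m]: acyclicity keeps [n] out of what [m]
    reaches. *)
Lemma acyclic_ind {N : finType} {e : rel N} {P : N -> Prop} :
  acyclic e -> (forall n, (forall m, e n m -> P m) -> P n) -> forall n, P n.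
Proof.
move=> acy IH n; have [k] := ubnP #|connect e n|; elim: k n => // k IHk n.
rewrite ltnS => le_k; apply: IH => m nm; apply: IHk; apply: leq_trans le_k.
apply: proper_card; apply/properP; split.
  by apply/subsetP => x; rewrite -!topredE /=; apply: connect_trans (connect1 nm).
by exists n; rewrite -?topredE /= ?connect0 // acy.
Qed.

Lemma term_seq_ind (S : signature) (P : term S -> Prop) :
  (forall x, P (Var x)) ->
  (forall f ts, (forall t, t \in ts -> P t) -> P (App f ts)) ->
  forall t, P t.
Proof.
move=> PV PA; fix IH 1; case=> [x|f ts]; first exact: PV.
(* With [IH] in context, [by] could close the empty case by an unguarded recursive call. *)
apply: PA; elim: ts => [u|t ts IHts u]; first by clear IH.
rewrite inE => /predU1P[->|]; [exact: IH | exact: IHts].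
Qed.

Section Terms.
Context {S : signature}.

Lemma wf_subterms (t u : term S) : wf_term t -> u \in subterms t -> wf_term u.
Proof.
elim/term_seq_ind: t => [x|f ts IH] /= wf_t; first by rewrite inE => /eqP ->.
rewrite inE => /predU1P[->|] //=; case/andP: wf_t => _ /allP wf_ts.
by case/flatten_mapP => t t_ts; apply: IH => //; apply: wf_ts.
Qed.

Lemma wf_formula_subterms {phi : formula S} {t : term S} :
  wf_formula phi -> t \in formula_subterms phi -> wf_term t.
Proof.
move=> /allP wf_phi /flatten_mapP[l /wf_phi/and3P[wf1 wf2 _]].
by rewrite mem_cat => /orP[]; apply: wf_subterms.
Qed.

Lemma mem_formula_subterms {phi : formula S} {l : literal S} : l \in phi ->
  l.1 \in formula_subterms phi /\ l.2 \in formula_subterms phi.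
Proof.
by move=> l_phi; split; apply/flatten_mapP; exists l => //;
  rewrite mem_cat; case: l.1 l.2 => [?|? ?] [?|? ?]; rewrite /= !inE eqxx ?orbT.
Qed.

End Terms.

Section Egraph.
Context {S : signature} {phi : formula S} {G : tgraph S} {r : node G -> node G}.
Hypotheses (wf_phi : wf_formula phi) (G_phi : egraph_of G phi).
Hypothesis adm_r : admissible r.

Local Lemma nttEG (n : node G) : ntt n = mk_term (label n) (map (@ntt S G) (child n)).
Proof. by case: G_phi => -[acy _ _ _] _ _; apply: nttE. Qed.

Local Lemma inr_child {n : node G} {x} : label n = inr x -> child n = [::].
Proof. by case: G_phi => -[_ lab_var _ _] _ _ /lab_var/size0nil. Qed.

Lemma wf_ntt (n : node G) : wf_term (ntt n).
Proof.
by case: G_phi => _ ntt_phi _; apply: (wf_formula_subterms wf_phi);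
  apply/ntt_phi; exists n.
Qed.

(** Having terms of equal sort is itself a congruence containing [phi], as a sort depends only on
    the head label; so it contains the least one. *)
Lemma sort_ntt_rho {n m : node G} :
  rho_root n m -> sort_of (ntt n) = sort_of (ntt m).
Proof.
case: (G_phi) => _ _ rho_cc /rho_cc.
move=> /(_ [rel u v | sort_of (ntt u) == sort_of (ntt v)]) cc.
apply/eqP/cc => [u v w | u v eq_lab _ deg_u _ | u v uv_phi] /=.
- by split=> [|/eqP->].
- rewrite !nttEG -eq_lab; case lab_u: (label u) => [f|x] //=.
- by have /and3P[] := allP wf_phi _ uv_phi.
Qed.

Local Lemma rho_repr (n : node G) : rho_root n (r n).
Proof. by case: adm_r => /(_ n); rewrite inE. Qed.

Local Lemma class_repr (n : node G) : class (r n) = class n.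
Proof.
by apply/setP => m; rewrite !inE /rho_root /= (eqP (rho_repr n)).
Qed.

Lemma sort_ntt_repr (n : node G) : sort_of (ntt (r n)) = sort_of (ntt n).
Proof. by rewrite (sort_ntt_rho (rho_repr n)). Qed.

(* The class of [n] is represented by [r n] rather than [eroot n], since
   [eroot n] need not belong to the class of [n]. *)
Definition class_univ : eqType := (node G + ssort S)%type.

Definition class_sort (u : class_univ) : ssort S :=
  match u with inl n => sort_of (ntt n) | inr s => s end.

Definition class_of_child (n : node G) : class_univ := inl (r n).

Definition class_fint (f : funsym S) (us : seq class_univ) : class_univ :=
  if [pick m | (label m == inl f) && (map class_of_child (child m) == us)]
    is Some m then inl (r m) else inr (fcod f).

Definition class_assign (x : lvar S) : class_univ :=
  if [pick m : node G | label m == inr x] is Some m then inl (r m)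
  else inr (vsort x).

Lemma class_dom_nonempty (s : ssort S) : exists u, class_sort u = s.
Proof. by exists (inr s). Qed.

Lemma class_fint_sort (f : funsym S) (us : seq class_univ) :
  map class_sort us = fdom f -> class_sort (class_fint f us) = fcod f.
Proof.
move=> _; rewrite /class_fint; case: pickP => //= m /andP[/eqP lab_m _].
by rewrite sort_ntt_repr nttEG lab_m.
Qed.

Definition class_structure : structure S :=
  Structure class_dom_nonempty class_fint_sort.

Local Notation ceval := (@eval S class_structure class_assign).

Lemma class_assignment : @assignment S class_structure class_assign.
Proof.
move=> x; rewrite /class_assign /=; case: pickP => //= m /eqP lab_m.
by rewrite sort_ntt_repr nttEG lab_m.
Qed.

(** The node picked by [class_fint] need not be [n], but it has the same label and child classes, so
    it falls in the class of [n]. *)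
Lemma eval_ntt (n : node G) : ceval (ntt n) = inl (r n).
Proof.
case: (G_phi) => -[acy _ [_ cong] ntt_inj] _ _.
move: n; apply: (acyclic_ind acy) => n IH; rewrite nttEG.
case lab_n: (label n) => [f|x] /=.
- have -> : map ceval (map (@ntt S G) (child n)) = map class_of_child (child n).
    by rewrite -map_comp; apply/eq_in_map => c /IH.
  rewrite /class_fint; case: pickP => [m|/(_ n)]; last by rewrite lab_n !eqxx.
  case/andP=> /eqP lab_m /eqP eq_ch; congr inl.
  case: adm_r => _ _ rP _; apply/rP.
  have eq_deg : deg m = deg n.
    by have := congr1 size eq_ch; rewrite !size_map.
  (* Congruence closure is silent on leaves; there equal labels give equal terms, and [ntt] is
     injective. *)
  case: (posnP (deg m)) => [deg0|deg_gt0].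
    suff -> : m = n by rewrite /rho_root /=.
    apply: ntt_inj; rewrite !nttEG lab_m lab_n (size0nil deg0).
    by move: deg0; rewrite eq_deg => /size0nil ->.
  apply: cong => // [|i i_lt]; first by rewrite lab_m.
  apply/rP; have := congr1 (fun us => nth (class_of_child m) us i) eq_ch.
  rewrite (nth_map m) // (nth_map n) -/(deg n) -?eq_deg //.
  by case.
- rewrite /class_assign; case: pickP => [m /eqP lab_m|/(_ n)]; last first.
    by rewrite lab_n eqxx.
  by congr (inl (r _)); apply: ntt_inj; rewrite !nttEG lab_m lab_n.
Qed.

Lemma holds_class_structure (l : literal S) :
  l \in phi -> @holds S class_structure class_assign l.
Proof.
case: (G_phi) => _ ntt_phi rho_cc l_phi.
have [/ntt_phi[n1 def1] /ntt_phi[n2 def2]] := mem_formula_subterms l_phi.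
rewrite /holds -def1 -def2 !eval_ntt; congr inl.
case: adm_r => _ _ rP _; apply/rP/rho_cc => R _ _; apply.
by rewrite def1 def2 -surjective_pairing.
Qed.

(** A value [inl n] of an application comes from a picked node [m] in the class of [n]. The child
    classes of [m] are values of ground arguments, hence ground by induction, so [m] is c-ground. *)
Lemma eval_ground {t : term S} {n : node G} :
  ground t -> ceval t = inl n -> class_ground (class n).
Proof.
elim/term_seq_ind: t n => // f ts IH n /= /allP gr_ts.
rewrite /class_fint; case: pickP => // m /andP[/eqP lab_m /eqP eq_ch] [<-].
rewrite class_repr; apply: (@ClassGround _ _ _ m); first by rewrite inE /rho_root /=.
case: (posnP (deg m)) => [deg0|deg_gt0].
  by apply: GroundNtt; rewrite nttEG lab_m (size0nil deg0).
apply: GroundChildren => // i i_lt; rewrite -class_repr.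
have : class_of_child (nth_child m i) \in map class_of_child (child m).
  by rewrite map_f // mem_nth.
rewrite eq_ch => /(@mapP _ class_univ)[t t_ts def_t].
by apply: (IH t) => //; apply: gr_ts.
Qed.

Lemma entails_class_ground {n : node G} {t : term S} :
  ground t -> entails phi (ntt n, t) -> class_ground (class n).
Proof.
move=> gr_t /(_ class_structure class_assign class_assignment).
move=> /(_ holds_class_structure); rewrite /holds /= eval_ntt => /esym.
by move=> /(eval_ground gr_t); rewrite class_repr.
Qed.

(** Replacing a child by its representative keeps its sort, so the well-sortedness of [ntt n]
    carries over. The sort is part of the induction because [wf_term] inspects the sorts of
    arguments. *)
Lemma wf_toexpr (n : node G) :
  wf_term (toexpr n r) /\ sort_of (toexpr n r) = sort_of (ntt n).
Proof.
case: (adm_r) => _ _ _ acy; move: n; apply: (acyclic_ind acy) => n IH.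
have := wf_ntt n; rewrite toexprE // nttEG.
case: (label n) => [f|x] //= /andP[/eqP <- _]; split=> //.
apply/andP; split.
  apply/eqP; rewrite -!map_comp; apply/eq_in_map => c c_n /=.
  by rewrite (IH (r c) (map_f r c_n)).2 sort_ntt_repr.
by rewrite all_map; apply/allP => c c_n /=; have [] := IH (r c) (map_f r c_n).
Qed.

Lemma cground_children {n c : node G} :
  cground n -> c \in child n -> class_ground (class c).
Proof.
case=> {n}n => [|_ gr_ch] => [|c_n]; last first.
  by rewrite -(nth_index n c_n); apply: gr_ch; rewrite /deg index_mem.
(* If [ntt n] itself is ground, each child is its own c-ground witness. *)
rewrite nttEG; case lab_n: (label n) => [f|x] //= /allP gr_ch c_n.
apply: (@ClassGround _ _ _ c); first by rewrite inE /rho_root /=.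
by apply/GroundNtt/gr_ch/map_f.
Qed.

Lemma ground_toexpr (n : node G) :
  maximally_ground r -> cground n -> ground (toexpr n r).
Proof.
move=> max_r; case: (adm_r) => _ _ _ acy.
move: n; apply: (acyclic_ind acy) => n IH gr_n; rewrite toexprE //.
case lab_n: (label n) => [f|x] /=.
  rewrite all_map; apply/allP => c c_n /=; apply: IH; first exact: map_f.
  (* Maximal groundness turns the ground class of [c] into a c-ground [r c], as the induction
     hypothesis requires. *)
  exact/max_r/(cground_children gr_n).
(* A node labelled by a variable is never c-ground: it has no children and its term is not
   ground. *)
have := inr_child lab_n; case: gr_n lab_n => {IH}n; last first.
  by rewrite /deg => + _ _ ch0; rewrite ch0.
by rewrite nttEG => + lab_n _; rewrite lab_n.
Qed.

End Egraph.

Theorem theorem2 (S : signature) (phi : formula S) (G : tgraph S)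
    (r : node G -> node G) :
  wf_formula phi -> egraph_of G phi ->
  admissible r -> maximally_ground r ->
  forall n : node G,
    (exists t : term S,
       [/\ ground_term t, wf_literal (ntt n, t) & entails phi (ntt n, t)]) ->
    cground (r n) /\ ground_term (toexpr (r n) r).
Proof.
move=> wf_phi G_phi adm_r max_r n [t [/andP[_ gr_t] _ phi_nt]].
have gr_rn : cground (r n).
  exact/max_r/(entails_class_ground wf_phi G_phi adm_r gr_t).
split=> //; apply/andP; split.
  exact: (wf_toexpr wf_phi G_phi adm_r _).1.
exact: (ground_toexpr G_phi adm_r).
Qed.
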